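(* Let $n \geqslant 2$, let $A \in M_n(\mathbb{C})$ be nonsingular with singular values $\sigma_1 \geqslant \sigma_2 \geqslant \cdots \geqslant \sigma_n > 0$, let $a_1$ be a real number with $0 < a_1 \leqslant \sigma_n$, and define $$a_{k+1}=\left(a_k^2+\left|\det\left(a_k^2 I_n-A^{H}A\right)\right|\left(\frac{n-1}{\|A\|_F^2-(n-1)a_k^2}\right)^{n-1}\right)^{1/2},\quad k=1,2,\dots.$$ Then $\sigma_n \geqslant a_{k+1} \geqslant a_k > 0$ for all $k=1,2,\dots$, and $\lim_{k\to+\infty} a_k=\sigma_n$.
   Context: $M_n(\mathbb{C})$ is the space of $n\times n$ complex matrices, $A^{H}$ is the conjugate transpose of $A$, $I_n$ is the $n \times n$ identity matrix, and $\|A\|_F=\left(\sum_{i,j=1}^n |a_{ij}|^2\right)^{1/2}$ is the Frobenius norm of $A=[a_{ij}]$. Singular values are listed in decreasing order with multiplicity. *)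

(* Defs.v *)
From HB Require Import structures.
From mathcomp Require Import all_boot all_order all_algebra.
From mathcomp Require Import complex.
From mathcomp Require Import all_classical all_reals all_analysis.

Set Implicit Arguments.
Unset Strict Implicit.
Unset Printing Implicit Defensive.

Import Order.TTheory GRing.Theory Num.Theory.
Import numFieldNormedType.Exports.

Local Open Scope ring_scope.
Local Open Scope complex_scope.
Local Open Scope sesquilinear_scope.

(* The real-valued modulus; [`|z|] on [R[i]] has type [R[i]]. *)
Definition cmod (R : realType) (z : R[i]) : R := ComplexField.Normc.normc z.

Definition frobenius_norm (R : realType) (n : nat) (A : 'M[R[i]]_n) : R :=
  Num.sqrt (\sum_(i < n) \sum_(j < n) cmod (A i j) ^+ 2).

(* The singular values are the nonnegative square roots of the eigenvalues of
   A^H A, counted with algebraic multiplicity: the last clause says that the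
   multiset of eigenvalues is the multiset of the squares of the entries of s.
   The 0-based entry [s`_i] is the (i+1)-st singular value. *)
Definition singular_values (R : realType) (n : nat) (A : 'M[R[i]]_n)
    (s : n.-tuple R) : Prop :=
  [/\ sorted >=%R s,
      all (fun x => 0 <= x) s &
      char_poly (A^t* *m A) = \prod_(x <- s) ('X - ((x ^+ 2)%:C)%:P)].

Lemma eigenvalue_gram_ge0 (R : realType) (n : nat) (A : 'M[R[i]]_n) (z : R[i]) :
  eigenvalue (A^t* *m A) z -> 0 <= z.
Proof.
move=> /eigenvalueP [v vB v0].
have e : dotmx (v *m A^t*) (v *m A^t*) = z * dotmx v v.
  rewrite !dotmxE trmx_mul map_mxM trmxCK -[LHS]/(_ 0 0) mulmxA.
  by rewrite -(mulmxA v) vB -scalemxAl mxE.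
have v0' : 0 < dotmx v v by rewrite dnorm_gt0.
by rewrite -(pmulr_lge0 _ v0') -e dnorm_ge0.
Qed.

Lemma singular_values_exist (R : realType) (n : nat) (A : 'M[R[i]]_n) :
  exists s : n.-tuple R, singular_values A s.
Proof.
set B := A^t* *m A.
have [r Hr] := closed_field_poly_normal (char_poly B).
rewrite (monicP (char_poly_monic _)) scale1r in Hr.
have szr : size r = n.
  have := size_char_poly B; rewrite Hr size_prod_XsubC; by case.
have rge0 z : z \in r -> 0 <= z.
  move=> zr; apply: (@eigenvalue_gram_ge0 _ _ A).
  by rewrite eigenvalue_root_char Hr root_prod_XsubC.
pose t := sort >=%R [seq Num.sqrt (complex.Re z) | z <- r].
have szt : size t == n by rewrite size_sort size_map szr.
exists (Tuple szt); split => /=.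
- by apply: sort_sorted => x y; exact: le_total.
- by rewrite all_sort all_map; apply/allP => z _ /=; exact: sqrtr_ge0.
- rewrite Hr (perm_big [seq Num.sqrt (complex.Re z) | z <- r]) ?perm_sort //=.
  rewrite big_map; apply: eq_big_seq => z /rge0.
  case: z => x y; rewrite lecE /= => /andP[/eqP -> x0].
  by rewrite sqr_sqrtr.
Qed.

(* Main.v *)
(* Put x_k = a_k^2, s_i = sigma_i^2 and F = ||A||_F^2 = tr(A^H A) = sum_i s_i.
   As long as x_k <= s_n the recursion reads x_{k+1} = x_k + (s_n - x_k) q_k,
   where q_k = prod_{i<n} (s_i - x_k) ((n-1) / (F - (n-1) x_k))^(n-1).  Since
   sum_{i<n} (s_i - x_k) <= F - (n-1) x_k, AM-GM gives 0 <= q_k <= 1, so a_k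
   increases and stays below sigma_n.  Bounding each factor of q_k from below
   by ((n-1)/F) (s_n - x_k) gives x_{k+1} >= x_k + c (s_n - x_k)^n with c > 0
   constant, and passing to the limit forces lim x_k = s_n. *)
Require Import Defs.
From HB Require Import structures.
From mathcomp Require Import all_boot all_order all_algebra.
From mathcomp Require Import complex.
From mathcomp Require Import all_classical all_reals all_analysis.
From mathcomp Require Import ring lra zify.

Import Order.TTheory GRing.Theory Num.Theory.
Import numFieldNormedType.Exports.

Local Open Scope classical_set_scope.
Local Open Scope ring_scope.
Local Open Scope complex_scope.
Local Open Scope sesquilinear_scope.

Lemma horner_char_poly (K : comNzRingType) (n : nat) (B : 'M[K]_n) (c : K) :
  (char_poly B).[c] = \det (c%:M - B).
Proof.
rewrite -horner_evalE -det_map_mx; congr (\det _).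
apply/matrixP => i j; rewrite !mxE /= horner_evalE.
by rewrite hornerD hornerN hornerC hornerMn hornerX.
Qed.

Lemma cmodE (R : realType) (z : R[i]) : (cmod z)%:C = `|z|.
Proof. by case: z. Qed.

Lemma cmod_real (R : realType) (x : R) : cmod x%:C = `|x|.
Proof. by rewrite /cmod /= expr0n addr0 sqrtr_sqr. Qed.

Lemma frobenius_norm_trace (R : realType) (n : nat) (A : 'M[R[i]]_n) :
  (frobenius_norm A ^+ 2)%:C = \tr (A^t* *m A).
Proof.
rewrite sqr_sqrtr; last first.
  by apply: sumr_ge0 => i _; apply: sumr_ge0 => j _; apply: sqr_ge0.
rewrite exchange_big rmorph_sum; apply: eq_bigr => i _.
rewrite mxE rmorph_sum; apply: eq_bigr => j _.
by rewrite rmorphXn /= cmodE normCKC !mxE.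
Qed.

Section SingularValues.
Variables (R : realType) (n : nat) (A : 'M[R[i]]_n) (s : n.-tuple R).
Hypothesis hs : singular_values A s.

(** By Vieta: up to sign, the coefficient of degree [n.-1] in the characteristic polynomial of
    [A^t* *m A] is both the trace and the sum of the roots [x ^+ 2]. This needs a positive [n]; for
    [n = 0] both sides vanish. *)
Lemma frobenius_norm_singular_values :
  frobenius_norm A ^+ 2 = \sum_(x <- s) x ^+ 2.
Proof.
have [n0|n_gt0] := posnP n.
  move: A s hs; rewrite {}n0 => A0 s0 _.
  by rewrite /frobenius_norm big_ord0 sqrtr0 tuple0 big_nil expr0n.
have [_ _ ps] := hs.
apply: complexI; rewrite frobenius_norm_trace -[LHS]opprK -char_poly_trace //.
pose r := [seq (x ^+ 2)%:C | x <- s].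
have sr : size r = n by rewrite size_map size_tuple.
rewrite ps -(big_map (fun x => (x ^+ 2)%:C) xpredT (fun z => 'X - z%:P)) -/r.
have := @coefPn_prod_XsubC _ r; rewrite sr -lt0n => -> //.
by rewrite opprK big_map rmorph_sum.
Qed.

(** The determinant is the characteristic polynomial evaluated at a real point; its roots are real,
    so the complex modulus reduces to real absolute values. *)
Lemma cmod_det_shifted_gram (c : R) :
  cmod (\det ((c%:C)%:M - A^t* *m A)) = \prod_(x <- s) `|x ^+ 2 - c|.
Proof.
have [_ _ ps] := hs.
rewrite -horner_char_poly ps horner_prod.
have -> : \prod_(x <- s) ('X - ((x ^+ 2)%:C)%:P).[c%:C]
          = (\prod_(x <- s) (c - x ^+ 2))%:C.
  by rewrite rmorph_prod; apply: eq_bigr => x _; rewrite hornerXsubC -rmorphB.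
by rewrite cmod_real normr_prod; apply: eq_bigr => x _; rewrite distrC.
Qed.

End SingularValues.

Lemma ler_prod_mean (R : realFieldType) (t : seq R) :
  all (fun x => 0 <= x) t ->
  \prod_(x <- t) x <= ((\sum_(x <- t) x) / (size t)%:R) ^+ size t.
Proof.
move=> /(all_nthP 0) t0; rewrite (big_nth 0) [X in X / _](big_nth 0) !big_mkord.
have /= := @leif_AGM R 'I_(size t) xpredT (fun i => t`_i).
rewrite card_ord => h; apply: h => i _; exact: t0.
Qed.

(* [q] is the factor q_k of the header, with [t] listing s_1, ..., s_{n-1},
   [y] = s_n and [x] = x_k. *)
Lemma increment_factor_bounds (R : realFieldType) (t : seq R) (x y : R) :
  (0 < size t)%N -> all (fun u => y <= u) t -> 0 < y -> 0 <= x <= y ->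
  let m := (size t)%:R in let F := \sum_(u <- t) u + y in
  let q := \prod_(u <- t) (u - x) * (m / (F - m * x)) ^+ size t in
  (m / F * (y - x)) ^+ size t <= q /\ q <= 1.
Proof.
move=> t0 /allP yt y0 /andP[x0 xy] m F q.
have m0 : 0 < m by rewrite ltr0n.
have sumB : \sum_(u <- t) (u - x) = F - y - m * x.
  rewrite big_split /= sumrN big_const_seq count_predT iter_addr addr0.
  by rewrite /F addrK /m mulr_natl.
have sum0 : 0 <= \sum_(u <- t) (u - x).
  by rewrite big_seq sumr_ge0 // => u /yt yu; rewrite subr_ge0 (le_trans xy).
(* The denominator is the sum of the [u - x] plus [y]. *)
have D0 : 0 < F - m * x by lra.
have mx0 : 0 <= m * x by rewrite mulr_ge0 // ltW.
have P0 : (y - x) ^+ size t <= \prod_(u <- t) (u - x).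
  have -> : (y - x) ^+ size t = \prod_(u <- t) (y - x).
    by rewrite big_const_seq count_predT iter_mulr_1.
  rewrite big_seq [leRHS]big_seq.
  apply: ler_prod => u /yt yu; lra.
have mD0 : 0 < m / (F - m * x) by rewrite divr_gt0.
split.
  (* Each [u - x] is at least [y - x], and replacing [F - m * x] by [F] enlarges the denominator. *)
  rewrite exprMn mulrC; apply: ler_pM => //.
  - by rewrite exprn_ge0 // subr_ge0.
  - by rewrite exprn_ge0 // divr_ge0 // ltW //; lra.
  - rewrite lerXn2r ?nnegrE ?divr_ge0 ?(ltW m0) ?(ltW D0) //; first lra.
    rewrite ler_pM2l // lef_pV2 ?posrE //; lra.
have := @ler_prod_mean R [seq u - x | u <- t].
rewrite all_map !big_map size_map => agm.
have {}agm := agm _.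
(* The mean of the [u - x] is [(F - y - m * x) / m]; discarding [y] leaves the reciprocal of the
   base in [q], so the two powers will cancel. *)
have {}agm : \prod_(u <- t) (u - x) <= ((F - m * x) / m) ^+ size t.
  apply: (le_trans (agm _)).
    by apply/allP => u /yt yu /=; rewrite subr_ge0 (le_trans xy).
  rewrite lerXn2r ?nnegrE ?divr_ge0 ?(ltW m0) ?(ltW D0) //.
  rewrite ler_pM2r ?invr_gt0 // sumB; lra.
rewrite /q (le_trans (ler_wpM2r _ agm)) ?exprn_ge0 ?(ltW mD0) //.
by rewrite -exprMn mulrA divfK ?gt_eqF // divff ?gt_eqF // expr1n.
Qed.

(** Monotone convergence gives a limit [L]; the increment inequality then passes to
    [c * (l ^+ 2 - L ^+ 2) ^+ n <= 0], impossible if [L < l]. *)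
Lemma cvg_sqr_increment (R : realType) (u : nat -> R) (l c : R) (n : nat) :
  0 < c -> (forall k, 0 <= u k <= l) ->
  (forall k, u k ^+ 2 + c * (l ^+ 2 - u k ^+ 2) ^+ n <= u k.+1 ^+ 2) ->
  u k @[k --> \oo] --> l.
Proof.
move=> c0 ul hu.
have l0 : 0 <= l by have /andP[u0 /(le_trans u0)] := ul 0%N.
have sq0 k : 0 <= l ^+ 2 - u k ^+ 2.
  by rewrite subr_ge0 lerXn2r ?nnegrE //; have /andP[] := ul k.
have u_nd : nondecreasing_seq u.
  apply/nondecreasing_seqP => k.
  have /andP[uk0 _] := ul k; have /andP[uk1 _] := ul k.+1.
  rewrite -(@ler_pXn2r _ 2) ?nnegrE //; apply: le_trans (hu k).
  by rewrite lerDl mulr_ge0 ?exprn_ge0 // ltW.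
have cu : cvgn u.
  apply: nondecreasing_is_cvgn => //; exists l => _ [k _ <-].
  by have /andP[] := ul k.
set L := limn u in cu.
have uL : u k @[k --> \oo] --> L by [].
have L0 : 0 <= L by apply: limr_ge => //; near=> k; have /andP[] := ul k.
have Ll : L <= l by apply: limr_le => //; near=> k; have /andP[] := ul k.
have u2L : u k ^+ 2 @[k --> \oo] --> L ^+ 2.
  exact: (continuous_cvg _ (@exprn_continuous R 2 L) uL).
have u2L1 : u k.+1 ^+ 2 @[k --> \oo] --> L ^+ 2.
  by move: u2L; rewrite -cvg_shiftS.
have hL : L ^+ 2 + c * (l ^+ 2 - L ^+ 2) ^+ n <= L ^+ 2.
  apply: (ler_cvg_to _ u2L1); last by near=> k; exact: hu.
  apply: cvgD => //; apply: cvgMl_tmp.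
  apply: (continuous_cvg _ (@exprn_continuous R n _)).
  by apply: cvgB => //; apply: cvg_cst.
suff -> : l = L by [].
apply/eqP; rewrite eq_le Ll andbT leNgt; apply/negP => Lltl.
have : 0 < c * (l ^+ 2 - L ^+ 2) ^+ n.
  by rewrite mulr_gt0 // exprn_gt0 // subr_gt0 ltrXn2r // nnegrE.
lra.
Unshelve. all: by end_near. Qed.

Theorem theorem1 (R : realType) (n : nat) (hn : (2 <= n)%N)
    (A : 'M[R[i]]_n) (hA : A \in unitmx)
    (sigma : n.-tuple R) (hsigma : singular_values A sigma)
    (a : nat -> R) (ha1 : 0 < a 1%N /\ a 1%N <= sigma`_n.-1)
    (ha : forall k : nat, (1 <= k)%N ->
       a k.+1 = Num.sqrt
         (a k ^+ 2
          + cmod (\det (((a k ^+ 2)%:C)%:M - A^t* *m A))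
            * ((n%:R - 1)
               / (frobenius_norm A ^+ 2 - (n%:R - 1) * a k ^+ 2)) ^+ n.-1)) :
  (forall k : nat, (1 <= k)%N ->
     [/\ a k.+1 <= sigma`_n.-1, a k <= a k.+1 & 0 < a k])
  /\ a k @[k --> \oo] --> sigma`_n.-1.
Proof.
have [s_sorted s_ge0 _] := hsigma.
have F_sum := frobenius_norm_singular_values _ _ _ _ hsigma.
have det_prod := cmod_det_shifted_gram _ _ _ _ hsigma.
have [a1_gt0 a1_le] := ha1.
set y := sigma`_n.-1 in a1_le *.
have y_gt0 : 0 < y by exact: lt_le_trans a1_le.
(* Splitting off the last singular value isolates the factor [y ^+ 2 - a k ^+ 2] of the determinant;
   the other [n.-1] factors go into [q k]. *)
have [t sE st] : exists2 t : seq R, sigma = rcons t y :> seq R & size t = n.-1.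
  have := size_tuple sigma; rewrite /y; case/lastP: (tval sigma) => [|t z].
    by move=> n0; rewrite -n0 in hn.
  by rewrite size_rcons => <-; exists t; rewrite ?nth_rcons ?ltnn ?eqxx.
have yt : all (fun u => y ^+ 2 <= u) [seq z ^+ 2 | z <- t].
  move: s_sorted; rewrite sorted_pairwise; last exact: ge_trans.
  rewrite sE pairwise_rcons => /andP[/allP yt _].
  apply/allP => _ /mapP[z /yt /= yz ->].
  by rewrite lerXn2r ?nnegrE ?(ltW y_gt0) // (le_trans (ltW y_gt0)).
have size_t : (0 < size [seq z ^+ 2 | z <- t])%N by rewrite size_map st; lia.
have nE : n%:R - 1 = n.-1%:R :> R by rewrite -subn1 natrB // ltnW.
pose F := \sum_(z <- t) z ^+ 2 + y ^+ 2.
pose q k := \prod_(z <- t) (z ^+ 2 - a k ^+ 2)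
  * (n.-1%:R / (F - n.-1%:R * a k ^+ 2)) ^+ n.-1.
have gap k : 0 < a k <= y -> 0 <= y ^+ 2 - a k ^+ 2.
  move=> /andP[ak0 aky].
  by rewrite subr_ge0 lerXn2r ?nnegrE ?(ltW ak0) ?(ltW y_gt0).
have qP k : 0 < a k <= y ->
    (n.-1%:R / F * (y ^+ 2 - a k ^+ 2)) ^+ n.-1 <= q k /\ q k <= 1.
  move=> hk.
  have := increment_factor_bounds _ _ (a k ^+ 2) _ size_t yt.
  rewrite !big_map size_map st /=; apply.
  - by rewrite exprn_gt0.
  - by rewrite sqr_ge0 -subr_ge0 gap.
have F_gt0 : 0 < F.
  by rewrite ltr_wpDl ?exprn_gt0 // sumr_ge0 // => z _; apply: sqr_ge0.
have n1_gt0 : 0 < n.-1%:R :> R by rewrite ltr0n; lia.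
have q_ge0 k : 0 < a k <= y -> 0 <= q k.
  move=> hk; have [+ _] := qP _ hk; apply: le_trans.
  apply/exprn_ge0/mulr_ge0; first by rewrite divr_ge0 ?ltW.
  exact: gap.
have step k : (1 <= k)%N -> 0 < a k <= y ->
    a k.+1 ^+ 2 = a k ^+ 2 + (y ^+ 2 - a k ^+ 2) * q k.
  move=> k1 hk; have yk := gap k hk.
  rewrite ha // F_sum det_prod nE sE !big_rcons /= -/F.
  (* All factors are nonnegative while [a k <= y], so the absolute values disappear. *)
  have -> : \prod_(z <- t) `|z ^+ 2 - a k ^+ 2| =
            \prod_(z <- t) (z ^+ 2 - a k ^+ 2).
    rewrite big_seq [RHS]big_seq; apply: eq_bigr => z zt.
    rewrite ger0_norm // subr_ge0; apply: (@le_trans _ _ (y ^+ 2)).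
      by rewrite -subr_ge0.
    by move/allP: yt; apply; apply/mapP; exists z.
  rewrite (ger0_norm yk) sqr_sqrtr; first by rewrite /q /F; ring.
  (* It remains to see that the radicand is nonnegative; regrouping exposes [q k]. *)
  have -> : forall P D : R, P * (y ^+ 2 - a k ^+ 2) * D
    = (y ^+ 2 - a k ^+ 2) * (P * D) by move=> P D; ring.
  by rewrite addr_ge0 ?sqr_ge0 // mulr_ge0 // q_ge0.
(* The recursion starts at index 1 and says nothing about [a 0], hence the shift. *)
have bnd k : 0 < a k.+1 <= y.
  elim: k => [|k IH]; first by rewrite a1_gt0.
  have /andP[ak0 aky] := IH; have yk := gap _ IH.
  have E := step k.+1 isT IH; have [_ q1] := qP _ IH.
  have a2_ge0 : 0 <= a k.+2 by rewrite ha ?sqrtr_ge0.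
  apply/andP; split.
    rewrite lt_def a2_ge0 andbT -sqrf_eq0 E gt_eqF //.
    by rewrite ltr_pwDl ?exprn_gt0 // mulr_ge0 // q_ge0.
  (* As [q k.+1 <= 1], the increment is at most the gap [y ^+ 2 - a k.+1 ^+ 2]. *)
  rewrite -(@ler_pXn2r _ 2) ?nnegrE ?(ltW y_gt0) // E.
  by rewrite -lerBrDl ler_piMr.
split.
  case=> // k _; have /andP[ak0 aky] := bnd k; have /andP[ak1 ak1y] := bnd k.+1.
  split=> //; rewrite -(@ler_pXn2r _ 2) ?nnegrE ?(ltW ak0) ?(ltW ak1) // (step k.+1) //.
  by rewrite lerDl mulr_ge0 ?q_ge0 ?gap.
rewrite -cvg_shiftS.
(* The constant comes from the lower bound in [qP]; the gap to the power [n.-1] there, times the gap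
   multiplying [q], gives the exponent [n]. *)
apply: (@cvg_sqr_increment _ _ _ ((n.-1%:R / F) ^+ n.-1) n) => [|k|k].
- by rewrite exprn_gt0 // divr_gt0.
- by have /andP[/ltW-> ->] := bnd k.
- have [qk _] := qP _ (bnd k).
  have -> : forall z : R, z ^+ n = z * z ^+ n.-1.
    by move=> z; rewrite -exprS prednK // ltnW.
  rewrite (step k.+1) // lerD2l mulrCA -exprMn.
  by rewrite ler_wpM2l ?gap.
Qed.
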